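(* Let $G$ be a finite group and let $n$ be a positive integer. Then the pair $(G\wr \mathcal{S}_n,\, G\wr \mathcal{S}_{n-1})$ is a Gelfand pair if and only if $G$ is abelian.
   Context: $\mathcal{S}_n$ denotes the symmetric group on $\{1,\ldots,n\}$, with product $pq=p\circ q$ (composition of permutations, $q$ applied first). Wreath product: for a finite group $G$, $G\wr \mathcal{S}_n$ is the group with underlying set $G^n\times \mathcal{S}_n$ and product $$((\sigma_1,\ldots,\sigma_n);p)\cdot((\epsilon_1,\ldots,\epsilon_n);q)=((\sigma_1\epsilon_{p^{-1}(1)},\ldots,\sigma_n\epsilon_{p^{-1}(n)});pq).$$ $G\wr \mathcal{S}_{n-1}$ is regarded as a subgroup of $G\wr \mathcal{S}_n$ via the standard embedding: it consists of the elements $((\sigma_1,\ldots,\sigma_n);p)$ with $\sigma_n=1_G$ and $p(n)=n$. (For $n=1$ this is the trivial subgroup.) Gelfand pair: for a finite group $H$ and a subgroup $K$ of $H$, let $$C(H,K)=\{f:H\to\mathbb{C} \mid f(kxk')=f(x)\text{ for all } x\in H \text{ and all } k,k'\in K\},$$ an algebra under the convolution product $(fg)(x)=\sum_{y\in H}f(y)g(y^{-1}x)$. The pair $(H,K)$ is called a Gelfand pair if the algebra $C(H,K)$ is commutative. *)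

(* Defs.v *)
From HB Require Import structures.
From mathcomp Require Import all_boot all_order all_algebra all_fingroup.
From mathcomp Require Import reals complex.

Set Implicit Arguments.
Unset Strict Implicit.
Unset Printing Implicit Defensive.

Import GroupScope GRing.Theory.

(* The set {1, ..., n} is 'I_n, so the index called i in the mathematics has
   ordinal value i - 1. *)
Section Wreath.
Variables (gT : finGroupType) (n : nat).

Record wreath := Wreath {
  wreath_base : {ffun 'I_n -> gT};
  wreath_perm : 'S_n
}.

Definition pair_of_wreath (x : wreath) := (wreath_base x, wreath_perm x).
Definition wreath_of_pair (u : {ffun 'I_n -> gT} * 'S_n) := Wreath u.1 u.2.

Lemma pair_of_wreathK : cancel pair_of_wreath wreath_of_pair.
Proof. by case. Qed.

HB.instance Definition _ := Finite.copy wreath (can_type pair_of_wreathK).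

(* The product of two permutations in MathComp is (p * q) i = q (p i), so the
   composite "p after q" is q * p. *)
Definition wreath_mul (x y : wreath) : wreath :=
  Wreath [ffun i => wreath_base x i * wreath_base y ((wreath_perm x)^-1 i)]
         (wreath_perm y * wreath_perm x).

Definition wreath_one : wreath := Wreath [ffun=> 1] 1.

Definition wreath_inv (x : wreath) : wreath :=
  Wreath [ffun i => (wreath_base x (wreath_perm x i))^-1] (wreath_perm x)^-1.

Lemma wreath_mulA : associative wreath_mul.
Proof.
move=> [a p] [b q] [c r]; congr Wreath; last by rewrite /= mulgA.
by apply/ffunP=> i; rewrite !ffunE /= mulgA invMg permM.
Qed.

Lemma wreath_mul1 : left_id wreath_one wreath_mul.
Proof.
move=> [a p]; congr Wreath; last by rewrite /= mulg1.
by apply/ffunP=> i; rewrite !ffunE /= mul1g invg1 perm1.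
Qed.

Lemma wreath_mulV : left_inverse wreath_one wreath_inv wreath_mul.
Proof.
move=> [a p]; congr Wreath; last by rewrite /= mulgV.
by apply/ffunP=> i; rewrite !ffunE /= invgK mulVg.
Qed.

HB.instance Definition _ :=
  Finite_isGroup.Build wreath wreath_mulA wreath_mul1 wreath_mulV.

(* The standard copy of the wreath product of gT with 'S_n.-1.  For 0 < n there is
   exactly one i : 'I_n with i.+1 = n, namely the last index; for n = 1 the set
   is the trivial subgroup. *)
Definition wreath_stab_set : {set wreath} :=
  [set x | [forall i : 'I_n, (i.+1 == n) ==>
             (wreath_base x i == 1) && (wreath_perm x i == i)]].

Lemma wreath_stab_group_set : group_set wreath_stab_set.
Proof.
apply/group_setP; split=> [|[a p] [b q]].
  by rewrite inE; apply/forallP=> i; rewrite /= ffunE perm1 !eqxx implybT.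
rewrite !inE /= => /forallP hp /forallP hq; apply/forallP=> i.
apply/implyP=> hi; move: (hp i) (hq i); rewrite hi /=.
move=> /andP[/eqP ai /eqP pi] /andP[/eqP bi /eqP qi].
by rewrite ffunE /= -{2}pi permK ai bi mulg1 permM qi pi !eqxx.
Qed.

Canonical wreath_stab : {group wreath} := Group wreath_stab_group_set.

End Wreath.

Section GelfandPair.
Variables (R : realType) (hT : finGroupType).
Implicit Types (K : {group hT}) (f g : {ffun hT -> R[i]}).

Definition bi_invariant K f : Prop :=
  forall (x k k' : hT), k \in K -> k' \in K -> f (k * x * k') = f x.

Definition convolution f g : {ffun hT -> R[i]} :=
  [ffun x => (\sum_(y : hT) f y * g (y^-1 * x)%g)%R].

Lemma convolution_bi_invariant K f g :
  bi_invariant K f -> bi_invariant K g -> bi_invariant K (convolution f g).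
Proof.
move=> hf hg x k k' hk hk'; rewrite !ffunE.
rewrite (reindex_inj (mulgI k)); apply: eq_bigr => y _ /=.
congr (_ * _)%R; first by rewrite -[X in f X]mulg1 hf.
by rewrite invMg !mulgA mulgKV -[_ * k']mul1g mulgA hg.
Qed.

(* H is the group of all elements of hT. *)
Definition gelfand_pair K : Prop :=
  forall f g, bi_invariant K f -> bi_invariant K g ->
    convolution f g = convolution g f.

End GelfandPair.

(* Main.v *)
Require Import Defs.
From HB Require Import structures.
From mathcomp Require Import all_boot all_order all_algebra all_fingroup.
From mathcomp Require Import reals complex.

(** Both directions rest on the transitive action of [wreath gT n] on pairs
    (index, element of [gT]), where (a; p) sends (i, g) to (p i, a (p i) * g):
    the subgroup [wreath_stab gT n] is the stabiliser of (last, 1), so the double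
    cosets are the orbits of the stabiliser on pairs.  These are the
    singletons {(last, g)}, and, if 1 < n, the set of all (i, g) with i not last.

    If [gT] is abelian, inversion in the wreath product followed by pointwise
    inversion in [gT] is an anti-automorphism.  It fixes every double coset: it
    does not change the entry a last when p last = last, and the elements with
    p last <> last form a single double coset.  Gelfand's trick
    ([gelfand_pair_anti]) then gives commutativity.

    Conversely, the elements with trivial permutation supported on the last
    coordinate form a copy of [gT] that centralises the subgroup, and the double
    coset of such an element is just its left coset.  Commutativity of the
    convolution algebra makes the copy of [gT] commute modulo the subgroup
    ([gelfand_pair_cent]); since the copy meets the subgroup trivially, [gT] is
    abelian. *)

Set Implicit Arguments.
Unset Strict Implicit.
Unset Printing Implicit Defensive.

Import GroupScope GRing.Theory Num.Theory.

(** * Gelfand pairs of finite groups *)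

Section GelfandCriteria.
Variables (R : realType) (hT : finGroupType) (K : {group hT}).

(** Gelfand's trick: composing with [tau] leaves bi-invariant functions
    unchanged, while it exchanges the two factors of a convolution. *)
Lemma gelfand_pair_anti (tau : hT -> hT) :
    injective tau -> (forall x y, tau (x * y) = tau y * tau x) ->
    (forall x, exists k k', [/\ k \in K, k' \in K & tau x = k * x * k']) ->
  gelfand_pair R K.
Proof.
move=> tau_inj tauM tauK f g hf hg.
have tau_inv (h : {ffun hT -> R[i]}) : bi_invariant K h -> forall z, h (tau z) = h z.
  by move=> hh z; have [k [k' [Kk Kk' ->]]] := tauK z; rewrite hh.
apply/ffunP=> x; rewrite -(tau_inv _ (convolution_bi_invariant hf hg)) !ffunE.
rewrite (reindex_inj tau_inj) (reindex_inj invg_inj) (reindex_inj (mulgI x^-1)).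
apply: eq_bigr => y _ /=; rewrite mulrC; congr (_ * _)%R.
  have -> : tau x = tau (x^-1 * y)^-1 * tau y.
    by rewrite -tauM invMg invgK mulKVg.
  by rewrite mulKg tau_inv.
by rewrite tau_inv // invMg invgK.
Qed.

Let indic (A : {set hT}) : {ffun hT -> R[i]} := [ffun z => (z \in A)%:R%R].

(** The value at [z] is the number of factorisations of [z] in [A * B], and
    [R[i]] has characteristic zero. *)
Lemma convolution_indic_neq0 (A B : {set hT}) z :
  (convolution (indic A) (indic B) z != 0)%R = (z \in A * B).
Proof.
rewrite ffunE (eq_bigr (fun y => ((y \in A) && ((y^-1 * z)%g \in B))%:R%R)); last first.
  by move=> y _; rewrite !ffunE -natrM mulnb.
rewrite -natr_sum pnatr_eq0 sum_nat_eq0 negb_forall.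
apply/existsP/mulsgP=> [[y]|[y t Ay Bt ->]].
  rewrite /= eqb0 negbK => /andP[Ay By].
  by exists y (y^-1 * z); rewrite ?mulKVg.
by exists y; rewrite /= mulKg Ay Bt.
Qed.

(** The left coset of an element that centralises [K] is a double coset, so its
    indicator function is bi-invariant. *)
Lemma bi_invariant_indic_cent x : x \in 'C(K) -> bi_invariant K (indic (x *: K)).
Proof.
move=> cKx z k k' Kk Kk'; rewrite !ffunE !mem_lcoset !mulgA groupMr //.
by rewrite (centP (groupVr cKx) k Kk) -mulgA groupMl.
Qed.

(** The indicator functions of the double cosets of [x] and [y] commute, and one
    of their convolutions is nonzero at [x * y], while the other is supported on
    [y * x *: K]. *)
Lemma gelfand_pair_cent x y :
    gelfand_pair R K -> x \in 'C(K) -> y \in 'C(K) ->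
  x * y \in y * x *: K.
Proof.
move=> gp cKx cKy.
have: x * y \in (x *: K) * (y *: K) by rewrite mem_mulg ?lcoset_refl.
rewrite -convolution_indic_neq0 gp; try exact: bi_invariant_indic_cent.
rewrite convolution_indic_neq0 => /mulsgP[_ _ /lcosetP[k Kk ->] /lcosetP[l Kl ->] ->].
suff -> : y * k * (x * l) = y * x * (k * l) by rewrite mem_lcoset mulKg groupM.
by rewrite !mulgA -(mulgA y k) -(centP cKx k Kk) mulgA.
Qed.

End GelfandCriteria.

(** * Double cosets in the wreath product *)

Section WreathStab.
Variables (gT : finGroupType) (m : nat).
Local Notation W := (wreath gT m.+1).
Local Notation K := (wreath_stab gT m.+1).
Implicit Types (x y : W) (g h : gT).

Lemma mem_wreath_stab x :
  (x \in K) = (wreath_base x ord_max == 1) && (wreath_perm x ord_max == ord_max).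
Proof.
rewrite inE; apply/forallP/idP=> [/(_ ord_max)|hx i]; first by rewrite eqxx.
by apply/implyP=> /eqP[im]; have -> : i = ord_max by apply: val_inj.
Qed.

Lemma wreath_baseM x y i :
  wreath_base (x * y) i = wreath_base x i * wreath_base y ((wreath_perm x)^-1 i).
Proof. by rewrite ffunE. Qed.

Lemma wreath_permM x y : wreath_perm (x * y) = wreath_perm y * wreath_perm x.
Proof. by []. Qed.

Lemma wreath_baseV x i :
  wreath_base x^-1 i = (wreath_base x (wreath_perm x i))^-1.
Proof. by rewrite ffunE. Qed.

Lemma wreath_permV x : wreath_perm x^-1 = (wreath_perm x)^-1.
Proof. by []. Qed.

(** The two conditions say that [x] and [y] send the base point (last, 1) to the
    same pair. *)
Lemma mem_lcoset_wreath_stab x y :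
    wreath_perm y ord_max = wreath_perm x ord_max ->
    wreath_base y (wreath_perm x ord_max) = wreath_base x (wreath_perm x ord_max) ->
  y \in x *: K.
Proof.
move=> Ep Eb; rewrite mem_lcoset mem_wreath_stab wreath_baseM wreath_baseV.
by rewrite wreath_permM wreath_permV invgK permM Ep Eb mulVg permK !eqxx.
Qed.

(** The stabiliser of (last, 1) is transitive on the pairs (i, g) with i not
    last. *)
Lemma wreath_moved_double_coset x y :
    wreath_perm x ord_max != ord_max -> wreath_perm y ord_max != ord_max ->
  exists k k', [/\ k \in K, k' \in K & y = k * x * k'].
Proof.
set i := wreath_perm x ord_max; set j := wreath_perm y ord_max => i_n j_n.
(* [k] sends (i, g) to (j, h), the images of (last, 1) under [x] and [y]. *)
pose k : W := Wreath
  [ffun l => if l == j then wreath_base y j * (wreath_base x i)^-1 else 1]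
  (tperm i j).
have Kk : k \in K.
  by rewrite mem_wreath_stab /= ffunE (negPf (_ : ord_max != j)) 1?eq_sym // tpermD
    // !eqxx.
have Ekx : wreath_perm (k * x) ord_max = j.
  by rewrite wreath_permM permM -/i tpermL.
have /lcosetP[k' Kk' ->] : y \in k * x *: K.
  apply: mem_lcoset_wreath_stab; rewrite Ekx // wreath_baseM /= ffunE eqxx tpermV.
  by rewrite tpermR mulgKV.
by exists k, k'.
Qed.

(** Inversion followed by pointwise inversion of the base component.  Inversion
    alone would send the double coset of (last, g) to that of (last, g^-1). *)
Definition wreath_anti x : W :=
  Wreath [ffun i => wreath_base x (wreath_perm x i)] (wreath_perm x)^-1.

Lemma wreath_anti_inj : injective wreath_anti.
Proof.
apply: (can_inj (g := wreath_anti)) => -[a p].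
congr Wreath; last by rewrite /= invgK.
by apply/ffunP=> i; rewrite !ffunE /= permKV.
Qed.

Lemma wreath_antiM : abelian [set: gT] ->
  forall x y, wreath_anti (x * y) = wreath_anti y * wreath_anti x.
Proof.
move=> /centsP cGG [a p] [b q]; congr Wreath; last by rewrite /= invMg.
apply/ffunP=> i; rewrite !ffunE /= invgK !permM permK.
by apply: cGG; rewrite inE.
Qed.

Lemma wreath_anti_double_coset x :
  exists k k', [/\ k \in K, k' \in K & wreath_anti x = k * x * k'].
Proof.
have [Ep|Np] := eqVneq (wreath_perm x ord_max) ord_max.
  have /lcosetP[k' Kk' ->] : wreath_anti x \in x *: K.
    apply: mem_lcoset_wreath_stab; first by rewrite /= -{1}Ep permK Ep.
    by rewrite Ep ffunE Ep.
  by exists 1, k'; rewrite group1 mul1g.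
apply: wreath_moved_double_coset => //=.
by apply: contraNneq Np => {1}<-; rewrite permKV.
Qed.

Definition wreath_last g : W := Wreath [ffun i => if i == ord_max then g else 1] 1.

Lemma wreath_last_cent g : wreath_last g \in 'C(K).
Proof.
apply/centP=> -[b q]; rewrite mem_wreath_stab /= => /andP[/eqP b1 /eqP qn].
congr Wreath; last by rewrite /= mulg1 mul1g.
apply/ffunP=> i; rewrite !ffunE /= invg1 perm1.
rewrite -[q^-1 i == _](inj_eq (@perm_inj _ q)) permKV qn.
by case: eqP => [->|_]; rewrite ?b1 mulg1 mul1g.
Qed.

Lemma wreath_lastM g h : wreath_last g * wreath_last h = wreath_last (g * h).
Proof.
congr Wreath; last by rewrite /= mulg1.
by apply/ffunP=> i; rewrite !ffunE /= invg1 perm1; case: eqP; rewrite ?mulg1.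
Qed.

Lemma wreath_last_lcoset g h : wreath_last g \in wreath_last h *: K -> g = h.
Proof.
rewrite mem_lcoset mem_wreath_stab wreath_baseM wreath_baseV wreath_permV /=.
rewrite invgK perm1 !ffunE eqxx => /andP[/eqP Egh _].
by rewrite -[g](mulKVg h) Egh mulg1.
Qed.

End WreathStab.

Theorem theorem1p1 (R : realType) (gT : finGroupType) (n : nat) (hn : 0 < n) :
  @gelfand_pair R (wreath gT n) (wreath_stab gT n) <-> abelian [set: gT].
Proof.
case: n hn => // m _; split=> [gp | abG].
  apply/centsP=> g _ h _; apply: (@wreath_last_lcoset gT m).
  rewrite -!wreath_lastM.
  by apply: gelfand_pair_cent gp _ _; apply: wreath_last_cent.
apply: (@gelfand_pair_anti R _ _ (@wreath_anti gT m)).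
- exact: wreath_anti_inj.
- exact: wreath_antiM.
- exact: wreath_anti_double_coset.
Qed.
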